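(* Let $q$ be a prime power with $q-1=ml^2$ for integers $l,m\ge 2$. Let $\theta$ be a primitive element of $\mathbb{F}_q$, put $\beta=\theta^l$, $C=\langle\beta^m\rangle=\langle\theta^{ml}\rangle\le\mathbb{F}_q^*$, $H=\langle\beta\rangle\le\mathbb{F}_q^*$, and $A_j=\beta^jC$ for $0\le j\le m-1$. Then for any $c\in\{1,\dots,m-1\}$, the family $\{A_0,\dots,A_{m-1}\}$ is a $(q,m,l;1)$-$c$-CEDF in $(\mathbb{F}_q,+)$ if and only if $$\{x-1:\ x\in A_c\}=\{\beta^{c+km}-1:\ 0\le k\le l-1\}$$ is a complete set of coset representatives of $H$ in $\mathbb{F}_q^*$. Moreover, if $l=2$ (so $q=4m+1$ and $\beta=\theta^2$), then for any $c\in\{1,\dots,m-1\}$, the family $\{A_0,\dots,A_{m-1}\}$ is a $(q,m,2;1)$-$c$-CEDF in $(\mathbb{F}_q,+)$ if and only if $\theta^{4c}-1$ is a non-square element of $\mathbb{F}_q^*$.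
   Context: Let $(G,+)$ be a finite abelian group of order $n$ (written additively), let $l,m\ge 2$, and let $S$ be a non-empty subset of $\{1,\dots,m-1\}$. For non-empty subsets $A,B\subseteq G$, $\Delta(A,B)$ denotes the multiset $\{\{a-b: a\in A, b\in B\}\}$. A family $\{A_0,\dots,A_{m-1}\}$ of $m$ pairwise disjoint subsets of $G$ is an $(n,m,l;\lambda)$-$S$-circular external difference family (CEDF) in $G$ if $|A_i|=l$ for all $i$ and each nonzero $g\in G$ occurs exactly $\lambda$ times in the multiset union $\bigcup_{c\in S}\bigcup_{i=0}^{m-1}\Delta(A_{i+c},A_i)$, where subscripts are taken modulo $m$. When $S=\{c\}$ this is called an $(n,m,l;\lambda)$-$c$-CEDF. *)

(* Defs.v *)
From HB Require Import structures.
From mathcomp Require Import all_boot all_order all_fingroup all_algebra.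
From mathcomp Require Import all_solvable all_field.

Set Implicit Arguments.
Unset Strict Implicit.
Unset Printing Implicit Defensive.

Import GRing.Theory.

Local Open Scope ring_scope.

Section CircularExternalDifferenceFamily.

Variable G : finZmodType.

(* Multisets over G are sequences, up to order: the multiplicity of g in s
   is count_mem g s, and multiset union is concatenation. *)
Definition Delta (A B : {set G}) : seq G :=
  [seq a - b | a <- enum A, b <- enum B].

Definition ord_shift (m : nat) (i : 'I_m) (c : nat) : 'I_m :=
  Ordinal (ltn_pmod (i + c)%N (leq_ltn_trans (leq0n i) (ltn_ord i))).

Definition circular_differences (m : nat) (S : {set 'I_m})
    (A : 'I_m -> {set G}) : seq G :=
  \big[cat/[::]]_(c in S) \big[cat/[::]]_(i < m) Delta (A (ord_shift i c)) (A i).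

Record is_S_CEDF (n m l lambda : nat) (S : {set 'I_m})
    (A : 'I_m -> {set G}) : Prop := IsSCEDF {
  cedf_order : #|G| = n;
  cedf_l_ge2 : (2 <= l)%N;
  cedf_m_ge2 : (2 <= m)%N;
  cedf_S_neq0 : S != set0;
  cedf_S_pos : forall c, c \in S -> (0 < c)%N;
  cedf_disjoint : forall i j, i != j -> [disjoint A i & A j];
  cedf_card : forall i, #|A i| = l;
  cedf_count : forall g, g != 0 ->
    count_mem g (circular_differences S A) = lambda
}.

Definition is_CEDF (n m l lambda : nat) (c : 'I_m) (A : 'I_m -> {set G}) :=
  is_S_CEDF n l lambda [set c] A.

End CircularExternalDifferenceFamily.

Arguments is_CEDF {G} n m l lambda c A.

Section CyclotomicFamily.

Variable F : finFieldType.

Definition primitive_element (theta : {unit F}) : bool :=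
  generator [set: {unit F}] theta.

Variables (theta : {unit F}) (l m : nat).

Definition cyc_beta : {unit F} := (theta ^+ l)%g.

Definition cyc_C : {group {unit F}} := <[cyc_beta ^+ m]>%G.

Definition cyc_H : {group {unit F}} := <[cyc_beta]>%G.

Definition cyc_A (j : 'I_m) : {set F} :=
  [set val u | u in lcoset cyc_C (cyc_beta ^+ j)%g].

End CyclotomicFamily.

Arguments cyc_A {F} theta l m j.

(* X is a set of elements of F; the witness T says that they are all units. *)
Definition complete_coset_reps (F : finFieldType) (H : {group {unit F}})
    (X : {set F}) : Prop :=
  exists2 T : {set {unit F}},
    X = [set val u | u in T] &
    is_transversal T (lcosets H [set: {unit F}]) [set: {unit F}].

Definition nonsquare_unit (F : finFieldType) (x : F) : Prop :=
  x != 0 /\ ~ (exists y : F, x = y ^+ 2).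

(* Main.v *)
(** The blocks [A_i] are the cosets of [C] in [H].  Writing
    [a - b = b (a / b - 1)], the pairs [(a, b)] in [A_(i+c) x A_i] are
    parametrised by [b] in [H] and [x = a / b] in [A_c], so a unit [g] occurs
    as a difference once for each [x] in [A_c] with [x - 1] in [g H].

    For [l = 2], [H] is the index-two group of squares, [-1 = beta ^ m] lies
    in [H] and [A_c - 1] consists of [beta ^ c - 1] and [- beta ^ c - 1].  These
    represent both cosets of [H] iff their product [- (theta ^ (4 c) - 1)] is
    not in [H]. *)

Require Import Defs.
From HB Require Import structures.
From mathcomp Require Import all_boot all_order all_fingroup all_algebra.
From mathcomp Require Import all_solvable all_field.

Set Implicit Arguments.
Unset Strict Implicit.
Unset Printing Implicit Defensive.

Import GRing.Theory.

Local Open Scope ring_scope.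

(** * Multiplicities in multisets of differences *)

Lemma count_mem_Delta (G : finZmodType) (A B : {set G}) (g : G) :
  count_mem g (Delta A B) = (\sum_(b in B) (g + b \in A)%R)%N.
Proof.
rewrite /Delta count_flatten -map_comp sumnE big_map big_enum /=.
under eq_bigr => a _ do rewrite count_map -sum1_count big_enum_cond /=.
(* With [b] outermost, the only candidate for [a] in [a - b = g] is [g + b]. *)
rewrite (exchange_big_dep (mem B)) /=; last by move=> a b _ /andP[].
apply: eq_bigr => b Bb.
under eq_bigl => a do rewrite Bb /= subr_eq.
rewrite sum1_card.
have [gbA|gbNA] := boolP (g + b \in A).
  rewrite /= -(card1 (g + b)); apply: eq_card => a; rewrite !inE.
  by rewrite unfold_in /=; case: eqP => [->|]; rewrite ?gbA ?andbF.
apply: eq_card0 => a; rewrite unfold_in /=.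
by apply: contraNF gbNA => /andP[aA /eqP <-].
Qed.

Lemma count_mem_circular_differences1 (G : finZmodType) (m : nat) (c : 'I_m)
    (A : 'I_m -> {set G}) (g : G) :
  count_mem g (circular_differences [set c] A) =
    (\sum_(i < m) \sum_(b in A i) (g + b \in A (ord_shift i c))%R)%N.
Proof.
rewrite /circular_differences big_set1.
rewrite (big_morph (count_mem g) (id1 := 0%N) (op1 := addn)) //.
  by apply: eq_bigr => i _; rewrite count_mem_Delta.
by move=> s t; rewrite count_cat.
Qed.

Lemma lcosets_partition (gT : finGroupType) (H G : {group gT}) :
  (H <| G)%g -> partition (lcosets H G) G.
Proof.
case/andP=> sHG nHG.
suff -> : lcosets H G = rcosets H G by apply: rcosets_partition.
apply: eq_in_imset => x Gx.
by rewrite lcosetE rcosetE norm_rlcoset ?(subsetP nHG).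
Qed.

Lemma val_unitXg (R : finUnitRingType) (u : {unit R}) n :
  val (u ^+ n)%g = val u ^+ n.
Proof. by elim: n => [|n IHn] //; rewrite expgS exprS -IHn. Qed.

(** * The blocks as cosets of [C] in the cyclic group [H] *)

Section Cyclotomy.

Variables (F : finFieldType) (l m : nat) (theta : {unit F}).
Hypotheses (hl : (2 <= l)%N) (hm : (2 <= m)%N).
Hypothesis hF : (#|F| - 1 = m * l ^ 2)%N.
Hypothesis htheta : primitive_element theta.

Let beta := cyc_beta theta l.
Let C := cyc_C theta l m.
Let H := cyc_H theta l.
Let A := cyc_A theta l m.

Lemma units_abelian : abelian [set: {unit F}].
Proof. by rewrite (eqP htheta) cycle_abelian. Qed.

Lemma order_primitive_element : #[theta]%g = (m * l ^ 2)%N.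
Proof. by rewrite -hF subn1 -card_finField_unit orderE (eqP htheta). Qed.

Lemma order_cyc_beta : #[beta]%g = (m * l)%N.
Proof.
rewrite /beta /cyc_beta orderXdiv order_primitive_element.
  by rewrite mulnA mulnK // ltnW.
by rewrite dvdn_mull // dvdn_mulr.
Qed.

Lemma card_cyc_C : #|C| = l.
Proof.
rewrite -orderE orderXdiv order_cyc_beta ?dvdn_mulr //.
by rewrite mulKn // ltnW.
Qed.

Lemma mem_cyc_A (j : 'I_m) (u : {unit F}) :
  (val u \in A j) = (u \in beta ^+ j *: C)%g.
Proof. by rewrite /A /cyc_A mem_imset ?lcosetE //; apply: val_inj. Qed.

Lemma card_cyc_A (j : 'I_m) : #|A j| = l.
Proof.
by rewrite card_imset ?lcosetE ?card_lcoset ?card_cyc_C //; apply: val_inj.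
Qed.

Lemma disjoint_cyc_lcosets (i j : 'I_m) : i != j ->
  [disjoint (beta ^+ i *: C)%g & (beta ^+ j *: C)%g].
Proof.
apply: contraR => /pred0Pn[u /andP[/= /lcosetP[_ /cycleP[a ->] ->]]].
case/lcosetP=> _ /cycleP[b ->]; rewrite -!(expgM beta) -!expgD => /eqP.
(* The exponents agree modulo [m * l], hence modulo [m], where the contributions of [C] vanish and
   only [i] and [j] remain. *)
rewrite eq_expg_mod_order order_cyc_beta => /eqP/(congr1 (modn^~ m)).
rewrite !modn_dvdm ?dvdn_mulr // !(mulnC m) ![(_ + _ * m)%N]addnC.
rewrite !modnMDl !modn_small ?ltn_ord // => eq_ij.
exact/eqP/val_inj.
Qed.

Lemma disjoint_cyc_A (i j : 'I_m) : i != j -> [disjoint A i & A j].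
Proof.
move=> neq_ij; apply/pred0Pn => -[_ /andP[/= /imsetP[u uAi ->]]].
rewrite mem_cyc_A => uAj; rewrite lcosetE in uAi.
by have /pred0P/(_ u) /= := disjoint_cyc_lcosets neq_ij; rewrite uAi uAj.
Qed.

Lemma bigcup_cyc_lcosets : (\bigcup_(i < m) (beta ^+ i *: C)%g = H)%g.
Proof.
apply/setP => u; apply/bigcupP/idP => [[i _ /lcosetP[_ /cycleP[a ->] ->]]|].
  by rewrite -(expgM beta) -expgD mem_cycle.
case/cycleP=> k ->; have m_gt0 := ltnW hm.
exists (Ordinal (ltn_pmod k m_gt0)) => //; apply/lcosetP.
exists ((beta ^+ m) ^+ (k %/ m))%g; first exact: mem_cycle.
by rewrite -(expgM beta) -expgD mulnC addnC -divn_eq.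
Qed.

(** Reducing [i + c] modulo [m] changes the power of [beta] only by a power of [beta ^+ m], which
    [C] absorbs. *)
Lemma lcoset_cyc_shift (i c : 'I_m) (h : {unit F}) : (h \in beta ^+ i *: C ->
  beta ^+ ord_shift i c *: C = h *: (beta ^+ c *: C))%g.
Proof.
case/lcosetP=> z Cz ->; rewrite -!lcosetM; apply/esym/lcoset_eqP.
rewrite mem_lcoset.
have -> : (beta ^+ i * z * beta ^+ c = beta ^+ (i + c) * z)%g.
  rewrite -mulgA (centsP units_abelian z _ (beta ^+ c)%g) ?inE //.
  by rewrite expgD mulgA.
rewrite {1}(divn_eq (i + c) m) addnC expgD mulgA mulKg mulnC expgM.
by rewrite groupM ?mem_cycle.
Qed.

(** Since 1 lies in [A 0 = C], disjointness excludes it from the other blocks. This is what makes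
    every [x - 1] with [x] in [A c] a unit. *)
Lemma one_notin_cyc_A (c : 'I_m) : (0 < c)%N -> 1 \notin A c.
Proof.
move=> c_gt0; pose i0 := Ordinal (ltnW hm : (0 < m)%N).
have neq_c0 : c != i0 by rewrite -val_eqE /= -lt0n.
apply/negP => A1; have /pred0P/(_ 1) /= := disjoint_cyc_A neq_c0.
rewrite A1 /=; rewrite -[1]/(val (1%g : {unit F})) mem_cyc_A.
by rewrite expg0 mul1g group1.
Qed.

(** * Counting differences by cosets of [H] *)

(** The set [A c - 1] lifted to the unit group, where it can be intersected with cosets of [H]. *)
Definition cyc_shifted_units (c : 'I_m) : {set {unit F}} :=
  [set u | val u + 1 \in A c].

Lemma val_cyc_shifted_units (c : 'I_m) : (0 < c)%N ->
  [set x - 1 | x in A c] = [set val u | u in cyc_shifted_units c].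
Proof.
move=> c_gt0; apply/setP => y; apply/imsetP/imsetP => [[x xA ->]|[u]].
  have x1 : x - 1 \is a GRing.unit.
    rewrite unitfE subr_eq0; apply: contraTneq xA => ->; exact: one_notin_cyc_A.
  by exists (FinRing.unit F x1); rewrite ?inE /= ?subrK.
by rewrite inE => uA ->; exists (val u + 1); rewrite ?addrK.
Qed.

Lemma complete_coset_reps_cyc (c : 'I_m) : (0 < c)%N ->
  complete_coset_reps H [set x - 1 | x in A c] <->
  forall u, #|cyc_shifted_units c :&: (u *: H)%g| = 1%N.
Proof.
move=> c_gt0; rewrite (val_cyc_shifted_units c_gt0); split=> [[T]|H1].
  (* Injectivity of [val] forces the witness [T] to be [cyc_shifted_units c]. *)
  move/(imset_inj val_inj) <- => /and3P[_ _ /forall_inP T1] u.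
  by apply/eqP/T1/lcosetsP; exists u; rewrite ?inE.
exists (cyc_shifted_units c) => //; apply/and3P; split.
- apply: lcosets_partition.
  by rewrite -sub_abelian_normal ?subsetT ?units_abelian.
- exact: subsetT.
- by apply/forall_inP => _ /lcosetsP[u _ ->]; rewrite H1.
Qed.

Lemma count_mem_cyc_differences (c : 'I_m) (u : {unit F}) :
  count_mem (val u) (circular_differences [set c] A) =
    #|cyc_shifted_units c :&: (u *: H)%g|.
Proof.
rewrite count_mem_circular_differences1.
(* [E h] tests whether [h] can be the subtrahend [b]: a difference [u] requires
   [x - 1 = h^-1 * u]. *)
pose E (h : {unit F}) : nat := (h^-1 * u)%g \in cyc_shifted_units c.
transitivity (\sum_(h in H) E h)%N.
  rewrite -bigcup_cyc_lcosets.
  rewrite (partition_disjoint_bigcup _ E disjoint_cyc_lcosets).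
  apply: eq_bigr => i _.
  rewrite big_imset /=; last by move=> ? ? _ _; apply: val_inj.
  rewrite lcosetE; apply: eq_bigr => h hi; congr nat_of_bool.
  rewrite /E inE /= /A /cyc_A !lcosetE (lcoset_cyc_shift c hi).
  (* Factoring out [h], which also carries [A c] onto the block with index [i + c], leaves a
     condition on [A c] alone. *)
  have -> : val u + val h = val h * (val (h^-1 * u)%g + 1).
    by rewrite mulrDr mulr1 /= mulrA divrr ?mul1r //; apply: valP.
  apply/imsetP/imsetP => [[v /lcosetP[w wc ->]]|[w wc eq_w]].
    by move/(mulrI (valP h)) => eq_w; exists w.
  exists (h * w)%g; first by rewrite mem_lcoset mulKg.
  exact: (congr1 ( *%R (val h)) eq_w).
rewrite -sum1_card big_mkcond [RHS]big_mkcond /=.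
(* The substitution [h |-> h^-1 * u] maps [H] onto [u *: H]; membership reduces to that of a
   conjugate of [h^-1], and [H] is normal because the unit group is abelian. *)
rewrite [RHS](reindex_inj (inj_comp (mulIg u) invg_inj)) /=.
apply: eq_bigr => h _; rewrite in_setI mem_lcoset -conjgE.
have nHG := subsetP (sub_abelian_norm units_abelian (subsetT H)).
rewrite memJ_norm ?nHG ?in_setT //.
by rewrite groupV /E; case: (h \in _); rewrite ?andbF ?andbT.
Qed.

Lemma is_CEDF_cyc (c : 'I_m) : (0 < c)%N ->
  is_CEDF #|F| m l 1 c A <->
  forall u, #|cyc_shifted_units c :&: (u *: H)%g| = 1%N.
Proof.
move=> c_gt0; split=> [[_ _ _ _ _ _ _ cntA] u | H1].
  by rewrite -count_mem_cyc_differences cntA // -unitfE; apply: valP.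
split=> //.
- by apply/set0Pn; exists c; rewrite inE.
- by move=> d /set1P->.
- exact: disjoint_cyc_A.
- exact: card_cyc_A.
- move=> g; rewrite -unitfE => Ug.
  by rewrite -[g]/(val (FinRing.unit F Ug)) count_mem_cyc_differences.
Qed.

Lemma sub1_cyc_AE (c : 'I_m) :
  [set x - 1 | x in A c] = [set val beta ^+ (c + k * m) - 1 | k : 'I_l].
Proof.
apply/setP => y; apply/imsetP/imsetP => [[x /imsetP[u]]|[k _ ->]].
  rewrite lcosetE => /lcosetP[_ /cyclePmin[k k_lt ->] ->] -> ->.
  rewrite -/beta [#[_]%g]card_cyc_C in k_lt.
  exists (Ordinal k_lt) => //.
  by rewrite -(expgM beta) -(expgD beta) val_unitXg mulnC.
exists (val beta ^+ (c + k * m)) => //.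
rewrite -val_unitXg mem_cyc_A expgD mem_lcoset mulKg mulnC expgM.
exact: mem_cycle.
Qed.

(** * Blocks of size two: squares and non-squares *)

Section TwoElementBlocks.

Hypothesis l2 : l = 2%N.

Lemma cyc_beta_expm_neq1 : (beta ^+ m != 1)%g.
Proof. by rewrite -order_eq1 [#[_]%g]card_cyc_C l2. Qed.

(** [beta ^+ m] has order 2, and a field has no square root of 1 besides 1 and -1. *)
Lemma val_cyc_beta_expm : val (beta ^+ m)%g = -1.
Proof.
have: val (beta ^+ m)%g ^+ 2 == 1.
  by rewrite -val_unitXg -(expgM beta) -{1}l2 -order_cyc_beta expg_order.
rewrite sqrf_eq1 => /orP[/eqP beta1|/eqP //].
by case/eqP: cyc_beta_expm_neq1; apply: val_inj.
Qed.

Lemma mem_cyc_H_square (u : {unit F}) :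
  reflect (exists y : F, val u = y ^+ 2) (u \in H).
Proof.
apply: (iffP idP) => [/cycleP[k ->]|[y eq_uy]].
  exists (val (theta ^+ k)%g); rewrite -val_unitXg.
  by rewrite /cyc_beta l2 -!(expgM theta) mulnC.
have Uy : y \is a GRing.unit.
  by rewrite -(unitrX_pos _ (isT : 0 < 2)%N) -eq_uy; apply: valP.
have -> : u = (FinRing.unit F Uy ^+ 2)%g by apply: val_inj; rewrite val_unitXg.
have : FinRing.unit F Uy \in <[theta]>%g by rewrite -(eqP htheta) inE.
case/cycleP=> k ->; rewrite -(expgM theta) mulnC (expgM theta) -{1}l2.
exact: mem_cycle.
Qed.

(** The unit group is [H] together with [theta * H], and [theta ^+ 2 = beta] lies in [H], so
    membership in [H] behaves like a sign. *)
Lemma mem_cyc_HM (u v : {unit F}) :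
  ((u * v)%g \in H) = ((u \in H) == (v \in H)).
Proof.
have thetaMH w : w \notin H -> exists2 h, h \in H & w = (theta * h)%g.
  have : w \in <[theta]>%g by rewrite -(eqP htheta) inE.
  case/cycleP=> k -> kNH; exists (beta ^+ k./2)%g; first exact: mem_cycle.
  rewrite /beta /cyc_beta l2 -(expgM theta) -(expgS theta) mul2n.
  have [odd_k|even_k] := boolP (odd k).
    by rewrite -add1n -[1%N]/(nat_of_bool true) -odd_k odd_double_half.
  case/negP: kNH; rewrite -(odd_double_half k) (negPf even_k) -mul2n -{1}l2.
  by rewrite (expgM theta) mem_cycle.
have [uH|uNH] := boolP (u \in H).
  by rewrite groupMl //; case: (v \in H).
have [vH|vNH] := boolP (v \in H); first by rewrite groupMr // (negPf uNH).
have [[h hH ->] [h' h'H ->]] := (thetaMH u uNH, thetaMH v vNH).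
have -> : (theta * h * (theta * h') = beta * (h * h'))%g.
  rewrite /beta /cyc_beta l2 (expgS theta 1) -!mulgA; congr (_ * _)%g.
  by rewrite !mulgA (centsP units_abelian h _ theta) ?inE.
by rewrite !groupM ?cycle_id.
Qed.

Lemma nonsquare_unitE (u : {unit F}) : nonsquare_unit (val u) <-> u \notin H.
Proof.
split=> [[_ nsq]|uNH]; first by apply/negP => /mem_cyc_H_square.
split; first by rewrite -unitfE; apply: valP.
by move/mem_cyc_H_square; apply/negP.
Qed.

Lemma card_cyc_shifted_units (c : 'I_m) : (0 < c)%N ->
  #|cyc_shifted_units c| = l.
Proof.
move=> c_gt0; rewrite -(card_imset _ val_inj) -val_cyc_shifted_units //.
by rewrite card_imset ?card_cyc_A //; apply: addIr.
Qed.

Lemma cyc_shifted_units2 (c : 'I_m) : (0 < c)%N ->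
  exists t1 t2 : {unit F}, [/\ t1 != t2, cyc_shifted_units c = [set t1; t2],
    val t1 = val beta ^+ c - 1 & val t2 = - val beta ^+ c - 1].
Proof.
move=> c_gt0; have := card_cyc_shifted_units c_gt0; rewrite l2.
have mem_shift x : x \in A c ->
    exists2 t, t \in cyc_shifted_units c & val t = x - 1.
  move=> xA; have : x - 1 \in [set val t | t in cyc_shifted_units c].
    by rewrite -val_cyc_shifted_units //; apply/imsetP; exists x.
  by case/imsetP=> t tT ->; exists t.
have bc : val (beta ^+ c)%g \in A c by rewrite mem_cyc_A lcoset_refl.
have bcm : val (beta ^+ c * beta ^+ m)%g \in A c.
  by rewrite mem_cyc_A mem_lcoset mulKg; apply: cycle_id.
have [[t1 t1T val_t1] [t2 t2T val_t2]] := (mem_shift _ bc, mem_shift _ bcm).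
move/eqP=> cardT; exists t1, t2.
have neq_t : t1 != t2.
  (* Equality would give [beta ^+ c * beta ^+ m = beta ^+ c], hence [beta ^+ m = 1]. *)
  apply/negP => /eqP eq_t; have : val t1 = val t2 by rewrite eq_t.
  rewrite val_t1 val_t2 => /addIr/val_inj/esym/eqP.
  rewrite -{2}[(beta ^+ c)%g]mulg1 (inj_eq (mulgI _)).
  exact/negP/cyc_beta_expm_neq1.
split=> //.
- apply/esym/eqP; rewrite eqEcard subUset !sub1set t1T t2T cards2 neq_t /=.
  by rewrite (eqP cardT).
- by rewrite val_t1 val_unitXg.
- by rewrite val_t2 -[- val beta ^+ c]mulrN1 -val_cyc_beta_expm -val_unitXg.
Qed.

Lemma card_cyc_shifted_units2_lcoset (c : 'I_m) : (0 < c)%N ->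
  (forall u, #|cyc_shifted_units c :&: (u *: H)%g| = 1%N) <->
  nonsquare_unit (val theta ^+ (4 * c) - 1).
Proof.
move=> c_gt0.
have [t1 [t2 [neq_t -> val_t1 val_t2]]] := cyc_shifted_units2 c_gt0.
(* With [b = beta ^+ c = theta ^+ (2 * c)], this is [b ^+ 2 - 1 = - ((b - 1) * (- b - 1))], the sign
   being [beta ^+ m]. *)
have -> : val theta ^+ (4 * c) - 1 = val (beta ^+ m * (t1 * t2))%g.
  rewrite -[RHS]/(val (beta ^+ m)%g * (val t1 * val t2)) val_cyc_beta_expm.
  rewrite val_t1 val_t2 /beta /cyc_beta l2 val_unitXg -!exprM.
  rewrite -opprD mulrN mulrNN mul1r -subr_sqr_1 -exprM.
  by congr (_ ^+ _ - 1); rewrite mulnAC.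
apply: (iff_trans _ (iff_sym (nonsquare_unitE _))).
rewrite groupMl ?mem_cycle // mem_cyc_HM.
(* As [H] has only two cosets, [t] lies in [u *: H] exactly when [t] and [u] are both in [H] or both
   outside it. *)
have cardE u : #|[set t1; t2] :&: (u *: H)%g| =
    (((u \in H) == (t1 \in H)) + ((u \in H) == (t2 \in H)))%N.
  have mem_uH t : (t \in (u *: H)%g) = ((u \in H) == (t \in H)).
    by rewrite mem_lcoset mem_cyc_HM groupV.
  rewrite -!mem_uH -sum1_card.
  rewrite (eq_bigl (fun t => (t \in [set t1; t2]) && (t \in (u *: H)%g))).
    by rewrite big_mkcondr big_setU1 ?inE //= big_set1; do 2 case: (_ \in _).
  by move=> t; rewrite in_setI.
(* The coset [H] alone already separates [t1] from [t2]; conversely, once separated, each coset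
   contains exactly one of them. *)
split=> [/(_ 1%g)|H12 u]; rewrite cardE.
  by rewrite group1; case: (t1 \in H); case: (t2 \in H).
by case: (u \in H) H12; case: (t1 \in H); case: (t2 \in H).
Qed.

End TwoElementBlocks.

End Cyclotomy.

(** * Both criteria, obtained from the common count over cosets of [H] *)

Theorem theorem2 (F : finFieldType) (q l m : nat) (theta : {unit F})
  (hq : #|F| = q) (hl : (2 <= l)%N) (hm : (2 <= m)%N)
  (hqml : (q - 1 = m * l ^ 2)%N)
  (htheta : primitive_element theta) :
  (forall c : 'I_m, (0 < c)%N ->
     [set x - 1 | x in cyc_A theta l m c]
       = [set val (cyc_beta theta l) ^+ (c + k * m) - 1 | k : 'I_l]
     /\ (is_CEDF q m l 1 c (cyc_A theta l m)
         <-> complete_coset_reps (cyc_H theta l)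
               [set x - 1 | x in cyc_A theta l m c]))
  /\
  (l = 2%N ->
   forall c : 'I_m, (0 < c)%N ->
     (is_CEDF q m 2 1 c (cyc_A theta l m)
      <-> nonsquare_unit (val theta ^+ (4 * c) - 1))).
Proof.
subst q; split=> [c c_gt0 | l2 c c_gt0].
  split; first exact: sub1_cyc_AE.
  exact: iff_trans (is_CEDF_cyc hl hm hqml htheta c_gt0)
    (iff_sym (complete_coset_reps_cyc hl hm hqml htheta c_gt0)).
rewrite -[X in is_CEDF _ _ X]l2.
exact: iff_trans (is_CEDF_cyc hl hm hqml htheta c_gt0)
  (card_cyc_shifted_units2_lcoset hl hm hqml htheta l2 c_gt0).
Qed.
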